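(* Let $X\subset\mathbb{R}^{d_1}$, $Y\subset\mathbb{R}^{d_2}$ be nonempty convex compact sets, let $G,H>0$, and let $\{\mathcal{L}_t\}_{t=1}^T$ be any sequence of functions $\mathcal{L}_t:X\times Y\to\mathbb{R}$ that are $H$-strongly convex-concave and $G$-Lipschitz with respect to a norm $\|\cdot\|$. Then the iterates $(x_t,y_t)$ of the algorithm SP-FTL run on this sequence (with arbitrary $(x_1,y_1)\in X\times Y$) satisfy $$\Bigl|\sum_{t=1}^T \mathcal{L}_t(x_t,y_t)-\min_{x\in X}\max_{y\in Y}\sum_{t=1}^T\mathcal{L}_t(x,y)\Bigr|\le \frac{8G^2}{H}(1+\ln T).$$
   Context: Norm convention: $\|\cdot\|$ is a norm on $\mathbb{R}^{d_1+d_2}$, and for $x\in\mathbb{R}^{d_1}$, $y\in\mathbb{R}^{d_2}$ one writes $\|x\|=\|[x;0]\|$, $\|y\|=\|[0;y]\|$, where $[x;y]$ denotes concatenation. A function $\mathcal{L}$ is $G$-Lipschitz w.r.t. $\|\cdot\|$ if $|\mathcal{L}(x_1,y_1)-\mathcal{L}(x_2,y_2)|\le G\|[x_1;y_1]-[x_2;y_2]\|$ for all points of $X\times Y$. A function $f:X\to\mathbb{R}$ is $H$-strongly convex if $f(x_1)\ge f(x_2)+\nabla f(x_2)^\top(x_1-x_2)+\frac H2\|x_1-x_2\|^2$ for all $x_1,x_2\in X$, where $\nabla f$ denotes a subgradient; $g$ is $H$-strongly concave if $-g$ is $H$-strongly convex. $\mathcal{L}(x,y)$ is $H$-strongly convex-concave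 if $\mathcal{L}(\cdot,y)$ is $H$-strongly convex for every fixed $y\in Y$ and $\mathcal{L}(x,\cdot)$ is $H$-strongly concave for every fixed $x\in X$. SP-FTL (Saddle-Point Follow-the-Leader): start with arbitrary $x_1\in X,y_1\in Y$; for $t\ge1$, after $\mathcal{L}_t$ is revealed, set $x_{t+1}\in\arg\min_{x\in X}\max_{y\in Y}\sum_{\tau=1}^t\mathcal{L}_\tau(x,y)$ and $y_{t+1}\in\arg\max_{y\in Y}\min_{x\in X}\sum_{\tau=1}^t\mathcal{L}_\tau(x,y)$. *)

(* Defs.v *)
From mathcomp Require Import all_boot all_order all_algebra.
From mathcomp Require Import all_classical all_reals all_analysis.

Set Implicit Arguments.
Unset Strict Implicit.
Unset Printing Implicit Defensive.

Import Order.TTheory GRing.Theory Num.Theory.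
Import numFieldNormedType.Exports.

Local Open Scope classical_set_scope.
Local Open Scope ring_scope.

(* Points of R^d are row vectors.  Functions on X (or on X x Y) are total
   functions of which only the values on X (or X x Y) are ever constrained. *)

Definition dotp (R : realType) (d : nat) (u v : 'rV[R]_d) : R :=
  (u *m v^T) 0 0.

(* An arbitrary norm, in general different from the library's sup norm `|x|. *)
Record is_norm (R : realType) (d : nat) (N : 'rV[R]_d -> R) : Prop := IsNorm {
  is_norm_triangle : forall u v, N (u + v) <= N u + N v ;
  is_norm_scale : forall (a : R) u, N (a *: u) = `|a| * N u ;
  is_norm_eq0 : forall u, N u = 0 -> u = 0 }.

Definition norm_fst (R : realType) (d1 d2 : nat) (N : 'rV[R]_(d1 + d2) -> R)
  (x : 'rV[R]_d1) : R := N (row_mx x 0).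

Definition norm_snd (R : realType) (d1 d2 : nat) (N : 'rV[R]_(d1 + d2) -> R)
  (y : 'rV[R]_d2) : R := N (row_mx 0 y).

Definition lipschitz_wrt (R : realType) (d1 d2 : nat)
    (N : 'rV[R]_(d1 + d2) -> R) (X : set 'rV[R]_d1) (Y : set 'rV[R]_d2)
    (G : R) (F : 'rV[R]_d1 -> 'rV[R]_d2 -> R) : Prop :=
  forall x1 x2 y1 y2, X x1 -> X x2 -> Y y1 -> Y y2 ->
    `|F x1 y1 - F x2 y2| <= G * N (row_mx x1 y1 - row_mx x2 y2).

Definition subgradient (R : realType) (d : nat) (X : set 'rV[R]_d)
    (f : 'rV[R]_d -> R) (x : 'rV[R]_d) : set 'rV[R]_d :=
  [set g | forall x', X x' -> f x + dotp g (x' - x) <= f x'].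

(* It is enough that one subgradient at each point satisfies the inequality;
   for convex X this already forces it for all subgradients at that point. *)
Definition strongly_convex (R : realType) (d : nat) (N : 'rV[R]_d -> R)
    (X : set 'rV[R]_d) (H : R) (f : 'rV[R]_d -> R) : Prop :=
  forall x2, X x2 ->
    exists2 g, subgradient X f x2 g &
      forall x1, X x1 ->
        f x1 >= f x2 + dotp g (x1 - x2) + H / 2 * N (x1 - x2) ^+ 2.

Definition strongly_concave (R : realType) (d : nat) (N : 'rV[R]_d -> R)
    (X : set 'rV[R]_d) (H : R) (f : 'rV[R]_d -> R) : Prop :=
  strongly_convex N X H (fun x => - f x).

Definition strongly_convex_concave (R : realType) (d1 d2 : nat)
    (N : 'rV[R]_(d1 + d2) -> R) (X : set 'rV[R]_d1) (Y : set 'rV[R]_d2)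
    (H : R) (F : 'rV[R]_d1 -> 'rV[R]_d2 -> R) : Prop :=
  (forall y, Y y -> strongly_convex (norm_fst N) X H (fun x => F x y)) /\
  (forall x, X x -> strongly_concave (norm_snd N) Y H (fun y => F x y)).

Definition is_max (R : realType) (A : set R) (m : R) : Prop :=
  A m /\ ubound A m.

Definition is_min (R : realType) (A : set R) (m : R) : Prop :=
  A m /\ lbound A m.

(* phi is the function x |-> max_(y in Y) F x y on X; the maxima are attained. *)
Definition inner_max (R : realType) (S T : Type) (X : set S) (Y : set T)
    (F : S -> T -> R) (phi : S -> R) : Prop :=
  forall x, X x -> is_max [set F x y | y in Y] (phi x).

(* psi is the function y |-> min_(x in X) F x y on Y; the minima are attained. *)
Definition inner_min (R : realType) (S T : Type) (X : set S) (Y : set T)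
    (F : S -> T -> R) (psi : T -> R) : Prop :=
  forall y, Y y -> is_min [set F x y | x in X] (psi y).

Definition argmin (R : realType) (S : Type) (X : set S) (f : S -> R) : set S :=
  [set x | X x /\ forall x', X x' -> f x <= f x'].

Definition argmax (R : realType) (S : Type) (X : set S) (f : S -> R) : set S :=
  [set x | X x /\ forall x', X x' -> f x' <= f x].

Definition argminmax (R : realType) (S T : Type) (X : set S) (Y : set T)
    (F : S -> T -> R) : set S :=
  [set x | exists2 phi, inner_max X Y F phi & argmin X phi x].

Definition argmaxmin (R : realType) (S T : Type) (X : set S) (Y : set T)
    (F : S -> T -> R) : set T :=
  [set y | exists2 psi, inner_min X Y F psi & argmax Y psi y].

(* v = min_(x in X) max_(y in Y) F x y, all extrema being attained. *)
Definition is_minmax (R : realType) (S T : Type) (X : set S) (Y : set T)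
    (F : S -> T -> R) (v : R) : Prop :=
  exists2 phi, inner_max X Y F phi & is_min [set phi x | x in X] v.

Lemma is_max_unique (R : realType) (A : set R) (m m' : R) :
  is_max A m -> is_max A m' -> m = m'.
Proof.
by move=> [Am um] [Am' um']; apply/eqP; rewrite eq_le um' ?um.
Qed.

Lemma is_min_unique (R : realType) (A : set R) (m m' : R) :
  is_min A m -> is_min A m' -> m = m'.
Proof.
by move=> [Am lm] [Am' lm']; apply/eqP; rewrite eq_le lm ?lm'.
Qed.

Lemma is_minmax_unique (R : realType) (S T : Type) (X : set S) (Y : set T)
    (F : S -> T -> R) (v v' : R) :
  is_minmax X Y F v -> is_minmax X Y F v' -> v = v'.
Proof.
move=> [phi Fphi minv] [phi' Fphi' minv'].
suff E : [set phi x | x in X] = [set phi' x | x in X].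
  by rewrite -E in minv'; exact: is_min_unique minv minv'.
by apply: eq_imagel => x Xx; exact: is_max_unique (Fphi x Xx) (Fphi' x Xx).
Qed.

(* The first T iterates of SP-FTL run on L 1, ..., L T: indices start at 1, as
   do the rounds, and the iterates 2, ..., T are determined by the leader rule. *)
Definition sp_ftl (R : realType) (S1 S2 : Type) (X : set S1) (Y : set S2)
    (T : nat) (L : nat -> S1 -> S2 -> R) (x : nat -> S1) (y : nat -> S2) : Prop :=
  [/\ X (x 1%N), Y (y 1%N) &
    forall t : nat, (1 <= t < T)%N ->
      argminmax X Y (fun u w => \sum_(1 <= tau < t.+1) L tau u w) (x t.+1) /\
      argmaxmin X Y (fun u w => \sum_(1 <= tau < t.+1) L tau u w) (y t.+1)].

(* Main.v *)
(* Let [S n] be the sum of the first [n] payoffs and [v n] its saddle value.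
   Strong convexity makes the minimax theorem elementary: perturb the minimiser
   of [max_y S n] along a segment, and the best replies converge.  Hence the
   leaders [(x n.+1, y n.+1)] form a saddle point of [S n], and
     v n.+1 <= S n.+1 (x n.+1) w = S n (x n.+1) w + L n.+1 (x n.+1) w
   for the maximising coordinate [w] of a saddle point of [S n.+1].  With
   [d] the distance from [w] to [y n.+1], strong concavity of [S n] gives
   [S n (x n.+1) w <= v n - n H d^2 / 4] and the Lipschitz bound gives
   [L n.+1 (x n.+1) w <= L n.+1 (x n.+1) (y n.+1) + G d]; maximising over [d],
   the increment of [v] exceeds the payoff of the round by at most
   [G^2 / (n H)].  The harmonic sum produces the logarithm, and exchanging the
   two players gives the reverse inequality. *)

Require Import Defs.
From mathcomp Require Import all_boot all_order all_algebra.
From mathcomp Require Import all_classical all_reals all_analysis.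
From mathcomp Require Import ring lra.

Set Implicit Arguments.
Unset Strict Implicit.
Unset Printing Implicit Defensive.

Import Order.TTheory GRing.Theory Num.Theory.
Import numFieldNormedType.Exports.

Local Open Scope classical_set_scope.
Local Open Scope ring_scope.

(** * Arbitrary norms and attained minima *)

Section norms.
Context (R : realType) (d : nat) (N : 'rV[R]_d -> R) (hN : is_norm N).

Lemma is_norm0 : N 0 = 0.
Proof. by rewrite -(scale0r 0) (is_norm_scale hN) normr0 mul0r. Qed.

Lemma is_normN u : N (- u) = N u.
Proof. by rewrite -scaleN1r (is_norm_scale hN) normrN1 mul1r. Qed.

Lemma is_normC u v : N (u - v) = N (v - u).
Proof. by rewrite -is_normN opprB. Qed.

Lemma is_norm_ge0 u : 0 <= N u.
Proof.
have := is_norm_triangle hN u (- u); rewrite subrr is_norm0 is_normN; lra.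
Qed.

Lemma is_norm_le_mx_norm : exists2 C, 0 <= C & forall u, N u <= C * `|u|.
Proof.
exists (\sum_j N (delta_mx 0 j)).
  by apply: sumr_ge0 => j _; exact: is_norm_ge0.
move=> u; rewrite {1}(row_sum_delta u) mulr_suml.
elim/big_ind2: _ => [|a1 b1 a2 b2 h1 h2|j _].
- by rewrite is_norm0.
- exact: le_trans (is_norm_triangle hN _ _) (lerD h1 h2).
rewrite (is_norm_scale hN) mulrC ler_wpM2l ?is_norm_ge0//.
by rewrite [leRHS]/Num.norm/= mx_normrE; apply/bigmax_geP; right; exists (0, j).
Qed.

(** Comparison with the sup norm turns the Lipschitz bound in [N] into continuity on [X], and
    compactness then yields a minimiser. *)
Lemma lipschitz_argmin (X : set 'rV[R]_d) (f : 'rV[R]_d -> R) (K : R) :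
  X !=set0 -> compact X ->
  (forall a b, X a -> X b -> `|f a - f b| <= K * N (a - b)) ->
  exists p, argmin X f p.
Proof.
move=> X0 cX lipf; have [C C0 NC] := is_norm_le_mx_norm.
have [|p /set_mem Xp pmin] := @EVT_min_rV R d f X X0 cX; last first.
  by exists p; split=> // z Xz; exact/pmin/mem_set.
apply/subspace_continuousP => a Xa.
apply/cvgrPdist_le => /= e e0; rewrite near_withinE.
(* Adding 1 keeps the constant positive when [K] or [C] vanishes. *)
have M0 : 0 < `|K| * C + 1 by rewrite ltr_wpDl// mulr_ge0.
near=> z => Xz.
apply: le_trans (lipf _ _ Xa Xz) _.
apply: (@le_trans _ _ ((`|K| * C + 1) * `|a - z|)).
  apply: (@le_trans _ _ (`|K| * (C * `|a - z|))).
    apply: le_trans (ler_wpM2r (is_norm_ge0 _) (ler_norm K)) _.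
    by rewrite ler_wpM2l.
  by rewrite mulrDl mulrA lerDl mul1r.
rewrite mulrC -ler_pdivlMr//.
near: z; apply: cvgr_dist_le (divr_gt0 e0 M0); exact: cvg_id.
Unshelve. all: by end_near. Qed.

End norms.

Lemma norm_fst_is_norm (R : realType) (d1 d2 : nat)
    (N : 'rV[R]_(d1 + d2) -> R) : is_norm N -> is_norm (norm_fst N).
Proof.
move=> hN; split=> [u v|a u|u]; rewrite /norm_fst.
- by rewrite -[in X in N X <= _](addr0 0) -add_row_mx (is_norm_triangle hN).
- by rewrite -(is_norm_scale hN) scale_row_mx scaler0.
by move/(is_norm_eq0 hN); rewrite -row_mx0 => /eq_row_mx[].
Qed.

Lemma norm_snd_is_norm (R : realType) (d1 d2 : nat)
    (N : 'rV[R]_(d1 + d2) -> R) : is_norm N -> is_norm (norm_snd N).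
Proof.
move=> hN; split=> [u v|a u|u]; rewrite /norm_snd.
- by rewrite -[in X in N X <= _](addr0 0) -add_row_mx (is_norm_triangle hN).
- by rewrite -(is_norm_scale hN) scale_row_mx scaler0.
by move/(is_norm_eq0 hN); rewrite -row_mx0 => /eq_row_mx[].
Qed.

(** * Strong convexity through Jensen's inequality *)

Lemma convex_set_segment (R : realType) (d : nat) (X : set 'rV[R]_d) a b l :
  convex_set X -> X a -> X b -> 0 < l < 1 -> X ((1 - l) *: a + l *: b).
Proof.
move=> cX Xa Xb /andP[l0 l1].
have := cX b a (Itv01 (ltW l0) (ltW l1)) (mem_set Xb) (mem_set Xa).
by move=> /set_mem; rewrite /conv/= addrC.
Qed.

(** The subgradient-free form of strong convexity with modulus [2 * c]; the constants add when
    functions are summed. *)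
Definition jensen_convex (R : realType) (d : nat) (N : 'rV[R]_d -> R)
    (X : set 'rV[R]_d) (c : R) (f : 'rV[R]_d -> R) : Prop :=
  forall a b l, X a -> X b -> 0 < l < 1 ->
    f ((1 - l) *: a + l *: b) + c * (l * (1 - l)) * N (a - b) ^+ 2
      <= (1 - l) * f a + l * f b.

Lemma dotpZ (R : realType) (d : nat) (k : R) (u v : 'rV[R]_d) :
  dotp u (k *: v) = k * dotp u v.
Proof. by rewrite /dotp linearZ /= -scalemxAr mxE. Qed.

(** Weighting the inequalities from [z] to [a] and [b] by [1 - l] and [l] cancels the linear terms;
    the squares combine by (1-l) l^2 + l (1-l)^2 = l (1-l). *)
Lemma strongly_convex_jensen (R : realType) (d : nat) (N : 'rV[R]_d -> R)
    (X : set 'rV[R]_d) (H : R) (f : 'rV[R]_d -> R) :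
  is_norm N -> convex_set X -> strongly_convex N X H f ->
  jensen_convex N X (H / 2) f.
Proof.
move=> hN cX scf a b l Xa Xb l01; set z := (1 - l) *: a + l *: b.
have Xz : X z by exact: convex_set_segment.
have [g _ sg] := scf _ Xz; have := sg _ Xb; have := sg _ Xa.
have -> : a - z = l *: (a - b).
  by apply/rowP => i; rewrite !mxE; ring.
have -> : b - z = (l - 1) *: (a - b).
  by apply/rowP => i; rewrite !mxE; ring.
rewrite !dotpZ !(is_norm_scale hN) !exprMn !real_normK ?num_real//.
move: l01 => /andP[l0 l1] ha hb.
have l1' : 0 <= 1 - l by rewrite subr_ge0 ltW.
apply: le_trans (lerD (ler_wpM2l l1' ha) (ler_wpM2l (ltW l0) hb)).
by rewrite le_eqVlt; apply/orP; left; apply/eqP; ring.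
Qed.

Lemma jensen_convex_le (R : realType) (d : nat) (N : 'rV[R]_d -> R)
    (X : set 'rV[R]_d) (c : R) (f : 'rV[R]_d -> R) a b l :
  0 <= c -> jensen_convex N X c f -> X a -> X b -> 0 < l < 1 ->
  f ((1 - l) *: a + l *: b) <= (1 - l) * f a + l * f b.
Proof.
move=> c0 jf Xa Xb l01; apply: le_trans (jf _ _ _ Xa Xb l01).
rewrite lerDl mulr_ge0 ?sqr_ge0// mulr_ge0//.
by case/andP: l01 => l0 l1; rewrite mulr_ge0 ?subr_ge0// ltW.
Qed.

(* The midpoint instance of Jensen's inequality loses a factor 2 against the
   optimal gap [c * N (p - z) ^+ 2]. *)
Lemma jensen_convex_gap (R : realType) (d : nat) (N : 'rV[R]_d -> R)
    (X : set 'rV[R]_d) (c : R) (f : 'rV[R]_d -> R) p z :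
  convex_set X -> jensen_convex N X c f -> argmin X f p -> X z ->
  f p + c / 2 * N (p - z) ^+ 2 <= f z.
Proof.
move=> cX jf [Xp pmin] Xz.
have h2 : 0 < (2^-1 : R) < 1 by lra.
have := jf _ _ _ Xp Xz h2; have := pmin _ (convex_set_segment cX Xp Xz h2).
lra.
Qed.

(** * Payoffs, their sums and the exchange of players *)

(** Each variable carries its own norm, so the conditions survive exchanging the players and
    negating [F]: an argument for one player serves both. *)
Record payoff (R : realType) (d1 d2 : nat) (N1 : 'rV[R]_d1 -> R)
    (N2 : 'rV[R]_d2 -> R) (X : set 'rV[R]_d1) (Y : set 'rV[R]_d2) (c K : R)
    (F : 'rV[R]_d1 -> 'rV[R]_d2 -> R) : Prop := Payoff {
  payoff_convex : forall y, Y y -> jensen_convex N1 X c (F^~ y) ;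
  payoff_concave : forall x, X x -> jensen_convex N2 Y c (fun y => - F x y) ;
  payoff_lipl : forall y, Y y -> forall x x', X x -> X x' ->
    `|F x y - F x' y| <= K * N1 (x - x') ;
  payoff_lipr : forall x, X x -> forall y y', Y y -> Y y' ->
    `|F x y - F x y'| <= K * N2 (y - y') }.

Definition saddle (R : realType) (S T : Type) (X : set S) (Y : set T)
    (F : S -> T -> R) (x : S) (y : T) : Prop :=
  [/\ X x, Y y, forall x', X x' -> F x y <= F x' y
    & forall y', Y y' -> F x y' <= F x y].

Lemma payoff_swap (R : realType) (d1 d2 : nat) (N1 : 'rV[R]_d1 -> R)
    (N2 : 'rV[R]_d2 -> R) X Y c K (F : 'rV[R]_d1 -> 'rV[R]_d2 -> R) :
  payoff N1 N2 X Y c K F -> payoff N2 N1 Y X c K (fun y x => - F x y).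
Proof.
case=> cvx ccv lipl lipr; split=> //.
- move=> y Yy; have := cvx _ Yy; congr jensen_convex.
  by apply/funext => x; rewrite opprK.
- by move=> x Xx y y' Yy Yy'; rewrite -opprD normrN lipr.
- by move=> y Yy x x' Xx Xx'; rewrite -opprD normrN lipl.
Qed.

Lemma saddle_swap (R : realType) (S T : Type) (X : set S) (Y : set T)
    (F : S -> T -> R) x y :
  saddle X Y F x y -> saddle Y X (fun y x => - F x y) y x.
Proof.
case=> Xx Yy minx maxy.
by split=> // z Zz; rewrite lerN2; [exact: maxy|exact: minx].
Qed.

Lemma payoffD (R : realType) (d1 d2 : nat) (N1 : 'rV[R]_d1 -> R)
    (N2 : 'rV[R]_d2 -> R) X Y c c' K K' (F F' : 'rV[R]_d1 -> 'rV[R]_d2 -> R) :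
  payoff N1 N2 X Y c K F -> payoff N1 N2 X Y c' K' F' ->
  payoff N1 N2 X Y (c + c') (K + K') (fun x y => F x y + F' x y).
Proof.
case=> cvx ccv lipl lipr [cvx' ccv' lipl' lipr']; split.
- move=> y Yy a b l Xa Xb l01.
  have := cvx _ Yy _ _ _ Xa Xb l01; have := cvx' _ Yy _ _ _ Xa Xb l01; lra.
- move=> x Xx a b l Xa Xb l01.
  have := ccv _ Xx _ _ _ Xa Xb l01; have := ccv' _ Xx _ _ _ Xa Xb l01; lra.
- move=> y Yy a b Xa Xb; rewrite opprD addrACA mulrDl.
  apply: le_trans (ler_normD _ _) _.
  by rewrite lerD ?lipl ?lipl'.
- move=> x Xx a b Xa Xb; rewrite opprD addrACA mulrDl.
  apply: le_trans (ler_normD _ _) _.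
  by rewrite lerD ?lipr ?lipr'.
Qed.

(** The convexity constant grows linearly with the number of rounds, which is what stabilises the
    leaders. *)
Lemma payoff_sum (R : realType) (d1 d2 : nat) (N1 : 'rV[R]_d1 -> R)
    (N2 : 'rV[R]_d2 -> R) X Y c K (L : nat -> 'rV[R]_d1 -> 'rV[R]_d2 -> R) n :
  (forall t, (1 <= t <= n.+1)%N -> payoff N1 N2 X Y c K (L t)) ->
  payoff N1 N2 X Y (n.+1%:R * c) (n.+1%:R * K)
    (fun x y => \sum_(1 <= t < n.+2) L t x y).
Proof.
elim: n => [|n IHn] pL.
  rewrite !mul1r (_ : (fun _ _ => _) = L 1%N); first exact: pL.
  by apply/funext => x; apply/funext => y; rewrite big_nat1.
rewrite -(natr1 n.+1) !mulrDl !mul1r.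
rewrite (_ : (fun _ _ => _) =
    fun x y => (\sum_(1 <= t < n.+2) L t x y) + L n.+2 x y).
  apply: payoffD; last by apply: pL; rewrite leqnn.
  by apply: IHn => t /andP[t1 tn]; apply: pL; rewrite t1 (leq_trans tn).
by apply/funext => x; apply/funext => y; rewrite big_nat_recr.
Qed.

Lemma strongly_convex_concave_payoff (R : realType) (d1 d2 : nat)
    (N : 'rV[R]_(d1 + d2) -> R) X Y G H F :
  is_norm N -> convex_set X -> convex_set Y ->
  strongly_convex_concave N X Y H F -> lipschitz_wrt N X Y G F ->
  payoff (norm_fst N) (norm_snd N) X Y (H / 2) G F.
Proof.
move=> hN cX cY [cvx ccv] lipF; split.
- move=> y Yy; apply: strongly_convex_jensen (norm_fst_is_norm hN) cX _.
  exact: cvx.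
- move=> x Xx; apply: strongly_convex_jensen (norm_snd_is_norm hN) cY _.
  exact: ccv.
- move=> y Yy a b Xa Xb; have := lipF _ _ _ _ Xa Xb Yy Yy.
  by rewrite opp_row_mx add_row_mx subrr.
- move=> x Xx a b Ya Yb; have := lipF _ _ _ _ Xx Xx Ya Yb.
  by rewrite opp_row_mx add_row_mx subrr.
Qed.

(** * Existence of saddle points *)

Section saddle_points.
Context (R : realType) (d1 d2 : nat) (N1 : 'rV[R]_d1 -> R) (N2 : 'rV[R]_d2 -> R).
Context (X : set 'rV[R]_d1) (Y : set 'rV[R]_d2) (c K : R).
Context (F : 'rV[R]_d1 -> 'rV[R]_d2 -> R).
Hypotheses (hN1 : is_norm N1) (hN2 : is_norm N2).
Hypotheses (X0 : X !=set0) (cX : convex_set X) (kX : compact X).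
Hypotheses (Y0 : Y !=set0) (cY : convex_set Y) (kY : compact Y).
Hypotheses (c0 : 0 < c) (K0 : 0 <= K) (pF : payoff N1 N2 X Y c K F).

Lemma payoff_inner_max : exists phi, inner_max X Y F phi.
Proof.
have /choice[phi Pphi] : forall x, exists m, X x -> is_max [set F x y | y in Y] m.
  (* Outside [X] the value 0 is a dummy. *)
  move=> x; have [Xx|nXx] := pselect (X x); last by exists 0.
  have lipF := payoff_lipl (payoff_swap pF) Xx.
  have [y [Yy ymin]] := lipschitz_argmin hN2 Y0 kY lipF.
  exists (F x y) => _; split; first by exists y.
  by move=> _ [y' Yy' <-]; rewrite -lerN2 ymin.
by exists phi.
Qed.

(** Let [x] minimise [phi] and [y] be a best reply to it. If some [x'] beat [x] against [y] by
    [e > 0], best replies to points near [x] would stay away from [y], against strong concavity. *)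
Lemma payoff_saddle : exists x y, saddle X Y F x y.
Proof.
have [phi Fphi] := payoff_inner_max.
have phi_le x y : X x -> Y y -> F x y <= phi x.
  by move=> Xx Yy; case: (Fphi _ Xx) => _; apply; exists y.
(* Test [phi x'] on the best reply [y] to [x]. *)
have phi_lip x x' : X x -> X x' -> phi x - phi x' <= K * N1 (x - x').
  move=> Xx Xx'; case: (Fphi _ Xx) => -[y Yy <-] _.
  have := phi_le _ _ Xx' Yy.
  have := le_trans (ler_norm _) (payoff_lipl pF Yy Xx Xx'); lra.
have [|x [Xx xmin]] := @lipschitz_argmin _ _ _ hN1 X phi K X0 kX.
  move=> a b Xa Xb; rewrite ler_norml phi_lip// andbT lerNl opprB is_normC//.
  exact: phi_lip.
have [[y Yy Fxy] _] := Fphi _ Xx.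
have ymax y' : Y y' -> F x y' <= F x y by rewrite Fxy; exact: phi_le.
exists x, y; split=> // x' Xx'; rewrite leNgt; apply/negP => Flt.
set e := F x y - F x' y; have e0 : 0 < e by rewrite subr_gt0.
set D := N1 (x - x'); have D0 : 0 <= D by exact: is_norm_ge0.
(* As [l] tends to 0, the best reply [y'] to [(1 - l) *: x + l *: x'] tends
   to [y]. *)
have main l : 0 < l < 1 -> c * e ^+ 2 <= l * (4 * K ^+ 3 * D).
  move=> l01; have Xl := convex_set_segment cX Xx Xx' l01.
  set xl := _ + _ in Xl.
  have xlx : N1 (x - xl) = l * D.
    rewrite -(@ger0_norm _ l) -?(is_norm_scale hN1); last by lra.
    by congr N1; apply/rowP => i; rewrite !mxE; ring.
  have [[y' Yy' Fy'] _] := Fphi _ Xl.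
  have jl := jensen_convex_le (ltW c0) (payoff_convex pF Yy') Xx Xx' l01.
  (* By convexity [phi x <= phi xl <= (1 - l) * F x y' + l * F x' y']; bound [F x y'] by [F x y] and
     divide by [l]. *)
  have le1 : F x y <= F x' y'.
    have := xmin _ Xl; rewrite -Fxy -Fy' => h.
    have := ymax _ Yy'; case/andP: l01 => l0 l1 h'.
    rewrite -(ler_pM2l l0); move: jl; rewrite -/xl /=.
    have l1' : 0 <= 1 - l by rewrite subr_ge0 ltW.
    by have := ler_wpM2l l1' h'; lra.
  have eK : e <= K * N2 (y - y').
    have := le_trans (ler_norm _) (payoff_lipr pF Xx' Yy' Yy).
    by rewrite is_normC//; rewrite /e; lra.
  (* Against [xl], [y'] does at least as well as [y]; passing between [xl] and [x] costs at most
     [K * l * D] for each reply. *)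
  have gap : c / 2 * N2 (y - y') ^+ 2 <= 2 * K * l * D.
    have amin : argmin Y (fun y => - F x y) y.
      by split=> // z Yz; rewrite lerN2 ymax.
    have := jensen_convex_gap cY (payoff_concave pF Xx) amin Yy'.
    have := le_trans (ler_norm _) (payoff_lipl pF Yy Xx Xl).
    have := le_trans (ler_norm _) (payoff_lipl pF Yy' Xl Xx).
    rewrite (is_normC hN1 xl) xlx.
    by have := phi_le _ _ Xl Yy; rewrite -Fy'; lra.
  have e2 : e ^+ 2 <= K ^+ 2 * N2 (y - y') ^+ 2.
    by rewrite -exprMn lerXn2r ?nnegrE ?(ltW e0)// mulr_ge0 ?is_norm_ge0.
  have := ler_wpM2l (ltW c0) e2.
  have := ler_wpM2l (sqr_ge0 K) gap; lra.
set A := 4 * K ^+ 3 * D in main.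
have A0 : 0 <= A by rewrite !mulr_ge0// exprn_ge0.
set B := c * e ^+ 2 in main.
have B0 : 0 < B by rewrite mulr_gt0 ?exprn_gt0.
have AB : 0 < A + B + 1 by lra.
(* This [l] turns [main] into [B * (A + B + 1) <= B * A], impossible for [B > 0]; the 1 keeps [l]
   below 1 when [A = 0]. *)
have /main : 0 < B / (A + B + 1) < 1.
  by rewrite divr_gt0//= ltr_pdivrMr// mul1r; lra.
rewrite mulrAC ler_pdivlMr//.
have := mulr_gt0 B0 B0; lra.
Qed.

End saddle_points.

(** * Leaders, saddle points and the minimax value *)

(** Each leader guarantees the saddle value [F x0 y0]: [F x] stays below it on [Y] and [F^~ y] above
    it on [X]. The two bounds meet at [(x, y)]. *)
Lemma argminmax_saddle (R : realType) (S T : Type) (X : set S) (Y : set T)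
    (F : S -> T -> R) x0 y0 x y :
  saddle X Y F x0 y0 -> argminmax X Y F x -> argmaxmin X Y F y ->
  saddle X Y F x y.
Proof.
move=> [Xx0 Yy0 min0 max0] [phi Fphi [Xx xmin]] [psi Fpsi [Yy ymax]].
have lex y' : Y y' -> F x y' <= F x0 y0.
  move=> Yy'; have [_ /(_ (F x y'))] := Fphi _ Xx.
  move=> /(_ (ex_intro2 _ _ _ Yy' erefl)) /le_trans; apply.
  apply: le_trans (xmin _ Xx0) _.
  by have [[z Yz <-] _] := Fphi _ Xx0; exact: max0.
have ley x' : X x' -> F x0 y0 <= F x' y.
  move=> Xx'; have [_ /(_ (F x' y))] := Fpsi _ Yy.
  move=> /(_ (ex_intro2 _ _ _ Xx' erefl)); apply: le_trans.
  apply: le_trans (ymax _ Yy0).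
  by have [[z Xz <-] _] := Fpsi _ Yy0; exact: min0.
have Fxy : F x y = F x0 y0 by apply/eqP; rewrite eq_le lex//= ley.
by split=> // z Zz; rewrite Fxy; [exact: ley|exact: lex].
Qed.

(** A saddle point provides the inner maximum at [x] only; [phi] supplies it on the rest of [X]. *)
Lemma saddle_minmax (R : realType) (S T : Type) (X : set S) (Y : set T)
    (F : S -> T -> R) phi x y :
  inner_max X Y F phi -> saddle X Y F x y -> is_minmax X Y F (F x y).
Proof.
move=> Fphi [Xx Yy minx maxy]; exists phi => //; split.
  exists x => //; have [[z Yz <-] ub] := Fphi _ Xx.
  by apply/eqP; rewrite eq_le maxy//=; apply: ub; exists y.
move=> _ [x' Xx' <-]; apply: le_trans (minx _ Xx') _.
by have [_] := Fphi _ Xx'; apply; exists y.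
Qed.

(** * One-sided regret bound *)

(** With m = n + 1: ln ((m+1)/m) = - ln (1 - 1/(m+1)) >= 1/(m+1) >= 1/(2m). *)
Lemma invS_le_ln (R : realType) (n : nat) :
  n.+1%:R^-1 <= 2 * (ln n.+2%:R - ln n.+1%:R) :> R.
Proof.
have a0 : 0 < n.+1%:R :> R by rewrite ltr0n.
have a1 : 1 <= n.+1%:R :> R by rewrite ler1n.
rewrite -ln_div ?posrE ?ltr0n//.
have eq1 : n.+2%:R / n.+1%:R = (1 - n.+2%:R^-1)^-1 :> R.
  rewrite -(natr1 n.+1); set m := n.+1%:R in a0 *.
  by field; rewrite addrK !gt_eqF// addr_gt0.
have b1 : n.+2%:R^-1 < 1 :> R by rewrite invf_lt1 ?ltr0n// ltr1n.
rewrite eq1 lnV ?posrE ?subr_gt0//.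
have : n.+1%:R^-1 <= 2 * n.+2%:R^-1 :> R.
  rewrite -(natr1 n.+1) -invf_div lef_pV2 ?posrE; lra.
have := @le_ln1Dx R (- n.+2%:R^-1); rewrite ltrN2 => /(_ b1).
by move: (n.+1%:R^-1) (n.+2%:R^-1) (ln _) => p q r; lra.
Qed.

Section regret.
Context (R : realType) (d1 d2 : nat) (N1 : 'rV[R]_d1 -> R) (N2 : 'rV[R]_d2 -> R).
Context (X : set 'rV[R]_d1) (Y : set 'rV[R]_d2) (c K : R).
Context (L : nat -> 'rV[R]_d1 -> 'rV[R]_d2 -> R).
Context (x : nat -> 'rV[R]_d1) (y : nat -> 'rV[R]_d2).
Hypotheses (hN2 : is_norm N2) (cY : convex_set Y) (c0 : 0 < c).

Local Notation S n := (fun u w => \sum_(1 <= t < n.+1) L t u w).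

(** Induction on the rounds: the 2 pays for the arbitrary first move, the logarithm for the later
    increments. *)
Lemma regret_le (n : nat) u w :
  (forall t, (1 <= t <= n.+1)%N -> payoff N1 N2 X Y c K (L t)) ->
  X (x 1%N) -> Y (y 1%N) ->
  (forall t, (1 <= t <= n)%N -> saddle X Y (S t) (x t.+1) (y t.+1)) ->
  saddle X Y (S n.+1) u w ->
  S n.+1 u w <= \sum_(1 <= t < n.+2) L t (x t) (y t)
                + K ^+ 2 / c * (2 + ln n.+1%:R).
Proof.
elim: n u w => [|n IHn] u w pL Xx1 Yy1 sad [Xu Yw minu maxw].
  rewrite ln1 addr0 !big_nat1 in minu maxw *.
  have pL1 := pL 1%N isT.
  have amin : argmin Y (fun w => - L 1%N u w) w.
    by split=> // z Yz; rewrite lerN2; have := maxw _ Yz; rewrite !big_nat1.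
  have := jensen_convex_gap cY (payoff_concave pL1 Xu) amin Yy1.
  have := le_trans (ler_norm _) (payoff_lipr pL1 Xu Yw Yy1).
  have := le_trans (ler_norm _) (payoff_lipr pL1 Xx1 Yw Yy1).
  have := minu _ Xx1; rewrite !big_nat1.
  have -> : K ^+ 2 / c * 2 = 2 * K ^+ 2 / c by ring.
  set d := N2 _ => h1 h2 h3 h4.
  (* Strong concavity at the maximiser [w] and the Lipschitz bound give [c / 2 * d ^+ 2 <= K * d].
     The identity below exploits this without dividing by [d], which may be 0. *)
  suff : K * d <= 2 * K ^+ 2 / c by lra.
  rewrite ler_pdivlMr// -subr_ge0.
  have -> : 2 * K ^+ 2 - K * d * c
            = 2 * (K - c * d / 2) ^+ 2 + c * (K * d - c / 2 * d ^+ 2) by field.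
  apply: addr_ge0; first by rewrite mulr_ge0 ?sqr_ge0.
  by apply: mulr_ge0; [exact: ltW|lra].
have pS : payoff N1 N2 X Y (n.+1%:R * c) (n.+1%:R * K) (S n.+1).
  by apply: payoff_sum => t /andP[t1 tn]; apply: pL; rewrite t1 (leq_trans tn).
have pLn : payoff N1 N2 X Y c K (L n.+2) by apply: pL; rewrite leqnn.
(* The leaders of the first [n.+1] rounds are played in round [n.+2]. *)
have sadn : saddle X Y (S n.+1) (x n.+2) (y n.+2) by apply: sad; rewrite leqnn.
have [Xp Yp _ maxp] := sadn.
have IH : S n.+1 (x n.+2) (y n.+2) <= \sum_(1 <= t < n.+2) L t (x t) (y t)
    + K ^+ 2 / c * (2 + ln n.+1%:R).
  by apply: IHn => // t /andP[t1 tn]; [apply: pL|apply: sad];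
    rewrite t1 (leq_trans tn).
have amin : argmin Y (fun w => - S n.+1 (x n.+2) w) (y n.+2).
  by split=> // z Yz; rewrite lerN2; exact: maxp.
have := jensen_convex_gap cY (payoff_concave pS Xp) amin Yw.
have := le_trans (ler_norm _) (payoff_lipr pLn Xp Yw Yp).
rewrite is_normC//.
have := minu _ Xp.
rewrite [in leRHS]big_nat_recr//= [X in _ -> _ -> _ -> _ <= X + _]big_nat_recr//=.
set d := N2 _ => h1 h2 h3.
have m0 : 0 < n.+1%:R :> R by rewrite ltr0n.
(* AM-GM: [2 K d <= K ^+ 2 / (m c) + m c d ^+ 2] *)
have amgm : K * d - n.+1%:R * c / 2 * d ^+ 2 <= K ^+ 2 / c / n.+1%:R / 2.
  rewrite -subr_ge0.
  have -> : K ^+ 2 / c / n.+1%:R / 2 - (K * d - n.+1%:R * c / 2 * d ^+ 2)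
            = (K - n.+1%:R * c * d) ^+ 2 / (2 * (n.+1%:R * c)).
    by field; rewrite ?gt_eqF// ?pnatr_eq0.
  by rewrite divr_ge0 ?sqr_ge0// !mulr_ge0// ltW.
have KC : 0 <= K ^+ 2 / c by rewrite divr_ge0 ?sqr_ge0// ltW.
(* The factor 2 of [invS_le_ln] cancels the [/ 2] in [amgm], and the logarithms telescope. *)
have := ler_wpM2l KC (invS_le_ln R n).
move: h1 h2 h3 amgm IH.
by move: (K ^+ 2 / c) (n.+1%:R * c / 2 * d ^+ 2) (K ^+ 2 / c / n.+1%:R)
  (ln n.+1%:R) (ln n.+2%:R) => *; lra.
Qed.

End regret.

(** * The two-sided bound *)

Theorem theorem1 (R : realType) (d1 d2 : nat)
  (N : 'rV[R]_(d1 + d2) -> R) (hN : is_norm N)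
  (X : set 'rV[R]_d1) (Y : set 'rV[R]_d2)
  (X0 : X !=set0) (Xconvex : convex_set X) (Xcompact : compact X)
  (Y0 : Y !=set0) (Yconvex : convex_set Y) (Ycompact : compact Y)
  (G H : R) (G0 : 0 < G) (H0 : 0 < H)
  (T : nat) (T0 : (1 <= T)%N)
  (L : nat -> 'rV[R]_d1 -> 'rV[R]_d2 -> R)
  (Lconv : forall t : nat, (1 <= t <= T)%N ->
     strongly_convex_concave N X Y H (L t))
  (Llip : forall t : nat, (1 <= t <= T)%N -> lipschitz_wrt N X Y G (L t))
  (x : nat -> 'rV[R]_d1) (y : nat -> 'rV[R]_d2)
  (hxy : sp_ftl X Y T L x y) :
  exists2 v : R,
    is_minmax X Y (fun u w => \sum_(1 <= t < T.+1) L t u w) v &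
    `|\sum_(1 <= t < T.+1) L t (x t) (y t) - v|
      <= 8 * G ^+ 2 / H * (1 + ln T%:R).
Proof.
case: T T0 Lconv Llip hxy => // n _ Lconv Llip [Xx1 Yy1 sp].
pose S m := fun u w => \sum_(1 <= t < m.+1) L t u w.
have hN1 := norm_fst_is_norm hN; have hN2 := norm_snd_is_norm hN.
have pL t : (1 <= t <= n.+1)%N ->
    payoff (norm_fst N) (norm_snd N) X Y (H / 2) G (L t).
  move=> tn; apply: strongly_convex_concave_payoff => //; first exact: Lconv.
  exact: Llip.
have pS m : (m <= n)%N ->
    payoff (norm_fst N) (norm_snd N) X Y
      (m.+1%:R * (H / 2)) (m.+1%:R * G) (S m.+1).
  move=> mn; apply: payoff_sum => t /andP[t1 tm].
  by apply: pL; rewrite t1 (leq_trans tm).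
have H20 : 0 < H / 2 by rewrite divr_gt0.
have saddleS m : (m <= n)%N -> exists u w, saddle X Y (S m.+1) u w.
  move=> mn; apply: payoff_saddle (pS _ mn) => //; first by rewrite mulr_gt0.
  by rewrite mulr_ge0// ltW.
have sad t : (1 <= t <= n)%N -> saddle X Y (S t) (x t.+1) (y t.+1).
  case: t => // t tn; have [u [w uw]] := saddleS t (ltnW tn).
  by have [xt yt] := sp t.+1 tn; exact: argminmax_saddle uw xt yt.
have [u [w uw]] := saddleS n (leqnn n).
have [phi Sphi] := payoff_inner_max hN2 Y0 Ycompact (pS n (leqnn n)).
exists (S n.+1 u w); first exact: saddle_minmax Sphi uw.
have upper := regret_le hN2 Yconvex H20 pL Xx1 Yy1 sad uw.
(* The same regret bound, for the payoffs [- L t] with the players exchanged. *)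
have lower : - S n.+1 u w <= - \sum_(1 <= t < n.+2) L t (x t) (y t)
    + G ^+ 2 / (H / 2) * (2 + ln n.+1%:R).
  have swapS m : (fun w u => \sum_(1 <= t < m.+1) - L t u w)
      = (fun w u => - S m u w).
    by apply/funext => a; apply/funext => b; rewrite sumrN.
  have := @regret_le R d2 d1 (norm_snd N) (norm_fst N) Y X (H / 2) G
    (fun t w u => - L t u w) y x hN1 Xconvex H20 n w u.
  rewrite -!sumrN; apply=> //.
  - by move=> t tn; exact/payoff_swap/pL.
  - by move=> t tn; rewrite swapS; exact/saddle_swap/sad.
  - by rewrite swapS; exact: saddle_swap.
have ln0 : 0 <= ln n.+1%:R :> R by rewrite ln_ge0// ler1n.
have GH : 0 <= G ^+ 2 / H by rewrite divr_ge0 ?sqr_ge0 ?ltW.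
(* With [c = H / 2] each side costs [G ^+ 2 / H] times 4 + 2 ln T, which is at most 8 (1 + ln T). *)
have bound : G ^+ 2 / (H / 2) * (2 + ln n.+1%:R)
    <= 8 * G ^+ 2 / H * (1 + ln n.+1%:R).
  have -> : G ^+ 2 / (H / 2) = 2 * (G ^+ 2 / H) by field; rewrite gt_eqF.
  have := mulr_ge0 GH ln0.
  by move: (ln _) GH => l; rewrite -(mulrA 8); move: (G ^+ 2 / H) => q; lra.
rewrite ler_norml; apply/andP; split.
  by rewrite lerNl opprB lerBlDl (le_trans upper)// lerD2l.
by rewrite lerBlDl -lerBlDr; move: lower bound; rewrite /S; lra.
Qed.
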